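(* Let $G$ be a graph and let $H\subseteq G$ be a subgraph with $V(H)=V(G)$ and $H$ connected. If $H$ is resistance positive, then $G$ is resistance positive.
   Context: All graphs $G=(V,E)$ are finite, simple (no multi-edges), loopless and connected. A spanning tree of $G$ is a maximal acyclic subset of edges $T\subseteq E$. For edge weights $c=(c_e)_{e\in E}$ with $0<c_e<\infty$, the relative resistance of $e\in E$ is $r_e(c)=\frac{\sum_{T\ni e}\prod_{t\in T}c_t}{\sum_{T}\prod_{t\in T}c_t}$, with sums over spanning trees $T$, and the resistance curvature of $v\in V$ is $p_v(c)=1-\frac12\sum_{uv\in E}r_{uv}(c)$ (sum over edges incident to $v$). $G$ is resistance positive (RP) if there exist weights $c$ with $p_v(c)>0$ for all $v\in V$. *)

(* Defs.v *)
From mathcomp Require Import all_boot all_order all_algebra.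
From mathcomp Require Import boolp reals.
Set Implicit Arguments.
Unset Strict Implicit.
Unset Printing Implicit Defensive.
Import Order.TTheory GRing.Theory Num.Theory.
Local Open Scope ring_scope.

(* An edge is the two-element set of its endpoints, so there are neither loops
   nor multi-edges. *)
Record sgraph (V : finType) := SGraph {
  edges : {set {set V}};
  edges_card2 : forall e, e \in edges -> #|e| = 2%N
}.

Section ResistanceCurvature.
Variables (R : realType) (V : finType).
Implicit Types (A E T : {set {set V}}) (G H : sgraph V) (c : {set V} -> R).

Definition adj A : rel V := fun x y => [set x; y] \in A.

Definition graph_connected G : Prop := forall x y, connect (adj (edges G)) x y.

Definition subgraph H G : bool := edges H \subset edges G.

(* The bound on the size is needed because [:: x; y] is a ucycle for every
   edge xy. *)
Definition acyclic A : Prop :=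
  forall s : seq V, (2 < size s)%N -> ~ ucycle (adj A) s.

Definition spanning_tree G T : bool :=
  maxset (fun A => (A \subset edges G) && `[< acyclic A >]) T.

Definition relative_resistance G c (e : {set V}) : R :=
  (\sum_(T | spanning_tree G T && (e \in T)) \prod_(t in T) c t) /
  (\sum_(T | spanning_tree G T) \prod_(t in T) c t).

Definition resistance_curvature G c (v : V) : R :=
  1 - 2^-1 * \sum_(e in edges G | v \in e) relative_resistance G c e.

(* Only the values of c on the edges of G matter. *)
Definition resistance_positive G : Prop :=
  exists c : {set V} -> R,
    (forall e, e \in edges G -> 0 < c e) /\
    (forall v, 0 < resistance_curvature G c v).

End ResistanceCurvature.

Arguments resistance_positive R {V} G.

(* Main.v *)
(** Give the edges of [G] outside [H] the small weight [eps].  Clearing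
    denominators, [p_v > 0] becomes [0 < \sum_T (2 - deg_T v) w(T)].  Because
    [H] is connected and spans [G], the spanning trees of [H] are exactly the
    spanning trees of [G] contained in [H]; these contribute the quantity for
    [H], which is positive, and every other tree has weight [O(eps)]. *)
Require Import Defs.
From mathcomp Require Import all_boot all_order all_algebra.
From mathcomp Require Import boolp reals.
Set Implicit Arguments.
Unset Strict Implicit.
Unset Printing Implicit Defensive.
Import Order.TTheory GRing.Theory Num.Theory.
Local Open Scope ring_scope.

Section SpanningTrees.
Variable V : finType.
Implicit Types (A B T : {set {set V}}) (G H : sgraph V).

Lemma adj_sym A : symmetric (adj A).
Proof. by move=> x y; rewrite /adj setUC. Qed.

Lemma adjS A B : A \subset B -> subrel (adj A) (adj B).
Proof. by move=> sAB x y; apply: (subsetP sAB). Qed.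

Lemma acyclicS A B : A \subset B -> acyclic B -> acyclic A.
Proof.
move=> sAB acB s s2 /andP[cs us]; apply: (acB s s2); apply/andP; split=> //.
exact: sub_cycle (adjS sAB) _ cs.
Qed.

Lemma acyclic0 : acyclic (set0 : {set {set V}}).
Proof. by move=> [|x [|y s]] //= _; rewrite /ucycle /= /adj inE. Qed.

(* A cycle using [xy] rotates to [z, b, p1, ...] with [{z, b} = {x, y}]; the
   rest of it, read from [b] back to [z], joins [x] and [y] inside [A]. *)
Lemma acyclicU1 A x y :
  acyclic A -> ~~ connect (adj A) x y -> acyclic ([set x; y] |: A).
Proof.
move=> acA nxy s s2 /andP[cs us].
have [csA|] := boolP (cycle (adj A) s); first by apply: (acA s s2); apply/andP.
apply/negP/negPn/(cycle_from_next us) => z zs.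
apply: contraNT nxy => nAz.
have [i s' Es] := rot_to zs.
have : cycle (adj ([set x; y] |: A)) (rot i s) by rewrite rot_cycle.
have : uniq (rot i s) by rewrite rot_uniq.
have : (2 < size (rot i s))%N by rewrite size_rot.
move: nAz; rewrite -(next_rot i us) Es.
case: s' {Es} => [|b [|p1 q]] //= nAz _ uq cq.
move: nAz; rewrite eqxx => nAz.
have Ezb : [set z; b] = [set x; y].
  case/andP: cq => + _; rewrite /adj in_setU1 => /orP[/eqP //|Azb].
  by rewrite /adj Azb in nAz.
(* The added edge is [[set z; b]] itself, so a step with an end outside that pair must already lie
   in [A]. *)
have stepA u v : (u \notin [set z; b]) || (v \notin [set z; b]) ->
    adj ([set x; y] |: A) u v -> adj A u v.
  move=> uv; rewrite /adj in_setU1 -Ezb => /orP[/eqP E|//].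
  by move: uv; rewrite -E !inE !eqxx !orbT.
have offzb w : w \in p1 :: q -> w \notin [set z; b].
  move: uq => /and3P[zq bq _] wq; rewrite !inE negb_or; apply/andP; split.
    by apply: contraNneq zq => <-; rewrite in_cons wq orbT.
  by apply: contraNneq bq => <-.
have cbz : connect (adj A) b z.
  apply/connectP; exists (rcons (p1 :: q) z); last by rewrite last_rcons.
  move: cq; rewrite /= !rcons_path => /and3P[_ bp1 /andP[pq qz]].
  apply/and3P; split.
  - by apply: stepA => //; rewrite (offzb p1) ?orbT ?mem_head.
  - have sub : {in p1 :: q &, subrel (adj ([set x; y] |: A)) (adj A)}.
      by move=> u v uq' _; apply: stepA; rewrite (offzb u).
    by apply: (sub_in_path sub) pq; apply/allP.
  - by apply: stepA => //; rewrite offzb ?mem_last.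
have symA := sym_connect_sym (@adj_sym A).
have : (x \in [set z; b]) && (y \in [set z; b]).
  by rewrite Ezb !inE !eqxx orbT.
rewrite !inE => /andP[/orP[]/eqP-> /orP[]/eqP->] //; last by rewrite symA.
Qed.

Lemma spanning_treeP G T :
  reflect [/\ T \subset edges G, acyclic T
            & forall B, B \subset edges G -> acyclic B -> T \subset B -> B = T]
          (spanning_tree G T).
Proof.
apply: (iffP maxsetP) => [[/andP[sT /asboolP acT] maxT]|[sT acT maxT]].
  split=> // B sB acB; apply: maxT; rewrite sB; exact/asboolP.
split; first by rewrite sT; exact/asboolP.
by move=> B /andP[sB /asboolP acB]; apply: maxT.
Qed.

Lemma spanning_tree_exists G : exists T, spanning_tree G T.
Proof.
have [|T tT _] := @maxset_exists _
  (fun A => (A \subset edges G) && `[< acyclic A >]) set0; last by exists T.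
by rewrite sub0set; apply/asboolP/acyclic0.
Qed.

(** If [T] left the ends of some edge of [G] unjoined, adding that edge would keep it acyclic,
    against maximality. So each step of a path in [G] can be replaced by a path in [T]. *)
Lemma spanning_tree_connected G T :
  graph_connected G -> spanning_tree G T -> forall x y, connect (adj T) x y.
Proof.
move=> cG /spanning_treeP[sT acT maxT] x y.
apply: connect_sub (cG x y) => {}x {}y Gxy; apply/negPn/negP => nxy.
have E : [set x; y] |: T = T.
  apply: maxT; rewrite ?subsetUr //; first by rewrite subUset sub1set sT andbT.
  exact: acyclicU1.
by case/negP: nxy; apply: connect1; rewrite /adj -E setU11.
Qed.

(** A simple path in [T] from [x] to [y] is closed into a cycle by the new edge. *)
Lemma connected_acyclicU1 T x y : x != y ->
  connect (adj T) x y -> [set x; y] \notin T -> ~ acyclic ([set x; y] |: T).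
Proof.
move=> nxy /connectP[p0 /shortenP[p pp up _] Ey]; move: nxy; rewrite {y}Ey.
case/lastP: p pp up => [|p z]; first by rewrite /= eqxx.
rewrite last_rcons => pp up _ nT ac.
(* A one-step path would be the new edge itself, which is not in [T]; hence the cycle has at least
   three vertices, as [acyclic] demands. *)
case: p => [|a p] in pp up; first by case/negP: nT; case/andP: pp.
apply: (ac (x :: rcons (a :: p) z)); first by rewrite /= size_rcons.
apply/andP; split=> //; rewrite /cycle rcons_path; apply/andP; split;
  last by rewrite last_rcons adj_sym /adj setU11.
exact: sub_path (adjS (subsetUr _ _)) _ _ pp.
Qed.

(** Maximality in [G] passes down to [H]. Conversely, a spanning tree of the connected [H] already
    joins all vertices, so any further edge of [G] closes a cycle. *)
Lemma spanning_tree_subgraph G H T : subgraph H G -> graph_connected H ->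
  spanning_tree G T && (T \subset edges H) = spanning_tree H T.
Proof.
move=> sHG cH; apply/andP/idP => [[/spanning_treeP[_ acT maxT] sTH]|tT].
  by apply/spanning_treeP; split=> // B sB; apply: maxT;
  apply: subset_trans sHG.
have /spanning_treeP[sT acT _] := tT.
split=> //; apply/spanning_treeP; split=> //; first exact: subset_trans sHG.
move=> B sB acB sTB; apply/eqP; rewrite eqEsubset sTB andbT.
apply/subsetP => e eB; apply/negPn/negP => eT.
have /eqP/cards2P[x [y [nxy Ee]]] := edges_card2 (subsetP sB _ eB).
apply: (connected_acyclicU1 nxy (spanning_tree_connected cH tT x y)).
  by rewrite -Ee.
by apply: acyclicS acB; rewrite subUset sub1set -Ee eB.
Qed.

End SpanningTrees.

Section Curvature.
Variables (R : realType) (V : finType).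
Implicit Types (T : {set {set V}}) (G H : sgraph V) (c : {set V} -> R).

Definition tree_degree T (v : V) : R := \sum_(e in T | v \in e) 1.

(** For positive weights this is the curvature at [v] times twice the total tree weight. It is
    polynomial in the weights, so it can be estimated tree by tree. *)
Definition curvature_numerator G c v : R :=
  \sum_(T | spanning_tree G T) (2 - tree_degree T v) * \prod_(t in T) c t.

Lemma tree_weight_gt0 G c T : (forall e, e \in edges G -> 0 < c e) ->
  T \subset edges G -> 0 < \prod_(t in T) c t.
Proof. by move=> c0 sT; apply: prodr_gt0 => e /(subsetP sT); apply: c0. Qed.

(** Exchanging the sums over edges and trees turns the total resistance at [v] into the weighted
    mean of [tree_degree T v]. The common denominator is positive because a spanning tree exists. *)
Lemma resistance_curvature_gt0 G c v : (forall e, e \in edges G -> 0 < c e) ->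
  (0 < resistance_curvature G c v) = (0 < curvature_numerator G c v).
Proof.
move=> c0; set Z := \sum_(T | spanning_tree G T) \prod_(t in T) c t.
have w0 T : spanning_tree G T -> 0 < \prod_(t in T) c t.
  by move=> /spanning_treeP[sT _ _]; apply: tree_weight_gt0 sT.
have Z0 : 0 < Z.
  have [T tT] := spanning_tree_exists G.
  rewrite /Z (bigD1 T) //= ltr_pwDl ?w0 //.
  by apply: sumr_ge0 => T' /andP[/w0/ltW].
suff -> : resistance_curvature G c v = curvature_numerator G c v / (2 * Z).
  by rewrite pmulr_lgt0 // invr_gt0 mulr_gt0.
rewrite /resistance_curvature /relative_resistance -mulr_suml -/Z.
rewrite (exchange_big_dep (spanning_tree G)) /=; last by move=> ? ? _ /andP[].
have -> : curvature_numerator G c v = 2 * Z -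
    \sum_(T | spanning_tree G T) tree_degree T v * \prod_(t in T) c t.
  by rewrite mulr_sumr -sumrB; apply: eq_bigr => T _; rewrite mulrBl.
rewrite mulrBl divff ?gt_eqF ?mulr_gt0 // invfM [in RHS]mulrCA.
congr (1 - _ * (_ / _)); apply: eq_bigr => T tT; rewrite mulr_suml.
apply: eq_big => [e|e _]; last by rewrite mul1r.
have /spanning_treeP[/subsetP sT _ _] := tT.
by rewrite tT andbC; have [/sT->|] := boolP (e \in T).
Qed.

Lemma curvature_numerator_perturb G H c v (eps : R) :
  subgraph H G -> graph_connected H -> (forall e, e \in edges H -> 0 < c e) ->
  0 < eps <= 1 ->
  curvature_numerator H c v
    - eps * (\sum_(T | spanning_tree G T) tree_degree T v *
               \prod_(t in T) (if t \in edges H then c t else 1))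
  <= curvature_numerator G (fun e => if e \in edges H then c e else eps) v.
Proof.
move=> sHG cH c0 /andP[eps0 eps1].
have d0 T : 0 <= tree_degree T v by apply: sumr_ge0.
have ce0 (a : R) t : 0 < a -> 0 < (if t \in edges H then c t else a).
  by move=> a0; case: ifPn => // /c0.
rewrite [leRHS](bigID (fun T => T \subset edges H)) /=; apply: lerD.
  rewrite le_eqVlt; apply/orP; left; apply/eqP.
  apply: eq_big => [T|T tT]; first by rewrite spanning_tree_subgraph.
  congr (_ * _); apply: eq_bigr => t tinT.
  by case/spanning_treeP: tT => /subsetP/(_ t tinT) -> _ _.
rewrite lerNl -sumrN mulr_sumr [leRHS](bigID (fun T => T \subset edges H)) /=.
apply: ler_wpDl.
  apply: sumr_ge0 => T _; rewrite mulr_ge0 ?(ltW eps0) // mulr_ge0 //.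
  by apply: prodr_ge0 => t _; apply/ltW/ce0.
apply: ler_sum => T /andP[_ /subsetPn[e eT eH]].
rewrite -mulNr opprB mulrCA.
have w0 : 0 <= \prod_(t in T) (if t \in edges H then c t else eps).
  by apply: prodr_ge0 => t _; apply/ltW/ce0.
apply: (le_trans (ler_wpM2r w0 (_ : _ <= tree_degree T v))).
  by rewrite lerBlDr lerDl.
(* The edge [e] outside [H] supplies the factor [eps]; the remaining factors are compared one by
   one, using [eps <= 1]. *)
apply: ler_wpM2l => //; rewrite (bigD1 e) //= [in leRHS](bigD1 e) //=.
rewrite (negPf eH) mul1r ler_wpM2l ?(ltW eps0) //; apply: ler_prod => t _.
by rewrite ltW ?ce0 //=; case: ifP.
Qed.

End Curvature.

(** Summing all the ratios [K i / a i] bounds each of them at once; the extra 1 makes the inequality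
    strict and keeps [eps <= 1], even for empty [I]. *)
Lemma exists_small_scale (R : realFieldType) (I : finType) (a K : I -> R) :
  (forall i, 0 < a i) -> (forall i, 0 <= K i) ->
  exists2 eps : R, 0 < eps <= 1 & forall i, eps * K i < a i.
Proof.
move=> a0 K0; set S := \sum_i K i / a i.
have q0 i : 0 <= K i / a i by rewrite divr_ge0 // ltW.
have S0 : 0 < 1 + S by rewrite ltr_pwDl // sumr_ge0.
exists (1 + S)^-1.
  by rewrite invr_gt0 S0 invf_le1 // lerDl sumr_ge0.
move=> i; rewrite mulrC ltr_pdivrMr // mulrC -ltr_pdivrMr //.
by rewrite ltr_pwDl // /S (bigD1 i) //= lerDl sumr_ge0.
Qed.

Theorem lemma6p1 (R : realType) (V : finType) (G H : sgraph V)
    (G_connected : graph_connected G)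
    (H_sub_G : subgraph H G)
    (H_connected : graph_connected H)
    (H_RP : resistance_positive R H) :
  resistance_positive R G.
Proof.
have [c [c0 pos]] := H_RP.
(* The error coefficient is taken with weight 1 outside [H], so it is independent of [eps], which
   can then be chosen from it. *)
pose K v := \sum_(T | spanning_tree G T) tree_degree R T v *
  \prod_(t in T) (if t \in edges H then c t else 1).
have a0 v : 0 < curvature_numerator H c v by rewrite -resistance_curvature_gt0.
have K0 v : 0 <= K v.
  apply: sumr_ge0 => T _; apply: mulr_ge0; first exact: sumr_ge0.
  by apply: prodr_ge0 => t _; case: ifPn => // /c0/ltW.
have [eps eps01 small] := exists_small_scale a0 K0.
exists (fun e => if e \in edges H then c e else eps).
have w0 e : e \in edges G -> 0 < (if e \in edges H then c e else eps).
  by move=> _; case/andP: eps01 => eps0 _; case: ifPn => // /c0.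
split=> // v; rewrite resistance_curvature_gt0 //.
apply: lt_le_trans (curvature_numerator_perturb v H_sub_G H_connected c0 eps01).
by rewrite subr_gt0 small.
Qed.
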